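(* In the setting described in the context, assume that the sequence $P\xrightarrow{d^-}\Sigma\xrightarrow{d}V'\to0$ is exact, that $d\,\Pi_\Sigma\Pi_Vv=J_Vv$ for all $v\in V$, and that the norm equivalence $\|\tau\|_\Sigma^2\eqsim\|\tau\|_{X'}^2+\|d\tau\|_{V'}^2$ for all $\tau\in\Sigma$ holds. Let $g\in\Sigma'$, $f\in V'$. Then the mixed formulation: find $(\sigma,u)\in\Sigma\times V$ such that $$(\sigma,\tau)_{X'}+\langle d\tau,u\rangle=\langle g,\tau\rangle\ \ \forall\,\tau\in\Sigma,\qquad\langle d\sigma,v\rangle=\langle f,v\rangle\ \ \forall\,v\in V,\tag{M}$$ can be decoupled in the following two ways. (i) (M) is equivalent to the three equations: find $w\in V$, $p\in P/\ker d^-$ and $u\in V$ such that $$(w,v)_V=\langle f,v\rangle\quad\forall\,v\in V,$$ $$(d^-p,d^-q)_{X'}=\langle g,d^-q\rangle-(\Pi_\Sigma\Pi_Vw,d^-q)_{X'}\quad\forall\,q\in P/\ker d^-,$$ $$(u,\chi)_V=\langle g,\Pi_\Sigma\Pi_V\chi\rangle-(\sigma,\Pi_\Sigma\Pi_V\chi)_{X'}\quad\forall\,\chi\in V,$$ where $\sigma=d^-p+\Pi_\Sigma\Pi_Vw$. (ii) When $(\cdot,\cdot)_{X'}$ is the inner product of the dual space $X'$, (M) is equivalent to the four equations: find $w,u\in V$, $\phi\in X$ and $p\in P/\ker d^-$ such that $$(w,v)_V=\langle f,v\rangle\quad\forall\,v\in V,$$ $$(\phi,\psi)_X-\langle d^-p,\psi\rangle=\langle\Pi_\Sigma\Pi_Vw,\psi\rangle\quad\forall\,\psi\in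 X,$$ $$\langle d^-q,\phi\rangle=\langle g,d^-q\rangle\quad\forall\,q\in P/\ker d^-,$$ $$(u,\chi)_V=\langle g-\phi,\Pi_\Sigma\Pi_V\chi\rangle\quad\forall\,\chi\in V,$$ where $\sigma=d^-p+\Pi_\Sigma\Pi_Vw$ and $\phi=J_X^{-1}\sigma$.
   Context: $X$, $V$, $\Sigma$ are Hilbert spaces, $P$ and $\widetilde\Sigma$ are Banach spaces, $'$ denotes continuous duals and $\langle\cdot,\cdot\rangle$ duality pairings; $\Sigma\subset X'$. For a Hilbert space $Y$, $J_Y:Y\to Y'$ is the isomorphism $\langle J_Yw,v\rangle=(w,v)_Y$; the inner product of $X'$ is $(w',v')_{X'}=(J_X^{-1}w',J_X^{-1}v')_X$. The maps $d^-:P\to\Sigma$, $d:\Sigma\to V'$, $\Pi_V:V\to\widetilde\Sigma$, $\Pi_\Sigma:\widetilde\Sigma\to\Sigma$ are continuous and linear (not necessarily isomorphisms). Exactness means $\ker(d)=\operatorname{img}(d^-)$ and $d$ is surjective. In general $(\cdot,\cdot)_{X'}$ is a symmetric positive semidefinite bilinear form on $X'$, with $\|\tau\|_{X'}=(\tau,\tau)_{X'}^{1/2}$. $\phi\in X$ acts on $\Sigma$ by $\tau\mapsto\langle\tau,\phi\rangle$ via $\Sigma\subset X'$. $a\eqsim b$ means each of $a,b$ is bounded by a constant multiple of the other. ''Equivalent'' means that solutions of one problem correspond to solutions of the other through the stated relations. *)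

(* Defs.v *)
From HB Require Import structures.
From mathcomp Require Import all_boot all_order all_algebra.
From mathcomp Require Import sesquilinear ring.
From mathcomp Require Import all_classical all_reals all_analysis.

Set Implicit Arguments.
Unset Strict Implicit.
Unset Printing Implicit Defensive.

Import Order.TTheory GRing.Theory Num.Theory.
Import numFieldNormedType.Exports.

Local Open Scope classical_set_scope.
Local Open Scope ring_scope.
Local Open Scope quotient_scope.

(* Real Hilbert spaces: [inner] is a form of type {dot V for idfun}, that is, a
   symmetric bilinear positive definite form, and it induces the norm. *)
HB.mixin Record NormedModule_hasInner (R : realType) V
    of NormedModule R V := {
  inner : {dot V for idfun} ;
  inner_normE : forall x : V, inner x x = `|x| ^+ 2 }.

#[short(type="hilbertType")]
HB.structure Definition Hilbert (R : realType) :=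
  {V of CompleteNormedModule R V & NormedModule_hasInner R V}.

Section Dual.
Variables (R : realType) (V : normedModType R).

Definition dual_pred : {pred V -> R^o} :=
  fun f => `[< linear f /\ continuous f >].

Record dual := Dual { dual_fun :> V -> R^o ; _ : dual_fun \in dual_pred }.

HB.instance Definition _ := [isSub for dual_fun].
HB.instance Definition _ := [Choice of dual by <:].

Lemma dual_submod_closed : submod_closed dual_pred.
Proof.
split.
  apply/asboolP; split; last exact: cst_continuous.
  by move=> a x y; rewrite /= /GRing.zero/= scaler0 addr0.
move=> a f g /asboolP[lf cf] /asboolP[lg cg]; apply/asboolP; split.
  move=> c x y.
  rewrite -[LHS]/(a *: f (c *: x + y) + g (c *: x + y)).
  rewrite -[in RHS]/(c *: (a *: f x + g x) + (a *: f y + g y)).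
  by rewrite lf lg !scalerDr !scalerA (mulrC a) addrACA.
move=> x; apply: cvgD; last exact: cg.
by apply: cvgZr; exact: cf.
Qed.

HB.instance Definition _ :=
  GRing.isSubmodClosed.Build R (V -> R^o) dual_pred dual_submod_closed.
HB.instance Definition _ := [SubChoice_isSubLmodule of dual by <:].

Lemma dual_linear (f : dual) : linear f.
Proof. by case: f => f /= /asboolP[]. Qed.

Lemma dual_continuous (f : dual) : continuous f.
Proof. by case: f => f /= /asboolP[]. Qed.

HB.instance Definition _ (f : dual) :=
  GRing.isLinear.Build R V R^o *:%R (dual_fun f) (dual_linear f).

Definition dual_norm (f : dual) : R :=
  sup [set `|f x| | x in [set x : V | `|x| <= 1]].

Lemma dual_has_sup (f : dual) :
  has_sup [set `|f x| | x in [set x : V | `|x| <= 1]].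
Proof.
split; first by exists `|f 0|, 0 => //=; rewrite normr0.
have /linear_bounded_continuous/bounded_funP/(_ 1)[M fM] := @dual_continuous f.
by exists M => _ [x /= x1 <-]; exact: fM.
Qed.

Lemma dual_norm_ub (f : dual) x : `|x| <= 1 -> `|f x| <= dual_norm f.
Proof. by move=> x1; apply: ub_le_sup; [case: (dual_has_sup f)|exists x]. Qed.

Lemma dual_norm_le (f : dual) M :
  (forall x, `|x| <= 1 -> `|f x| <= M) -> dual_norm f <= M.
Proof.
move=> fM; apply: ge_sup; first by case: (dual_has_sup f).
by move=> _ [x /= x1 <-]; exact: fM.
Qed.

Lemma dual_normD (f g : dual) : dual_norm (f + g) <= dual_norm f + dual_norm g.
Proof.
apply: dual_norm_le => x x1; rewrite (le_trans (ler_normD _ _))//.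
by rewrite lerD// dual_norm_ub.
Qed.

Lemma dual_norm_ge0 (f : dual) : 0 <= dual_norm f.
Proof. by rewrite (le_trans _ (@dual_norm_ub f 0 _))// normr0. Qed.

Lemma dual_normZ (l : R) (f : dual) : dual_norm (l *: f) = `|l| * dual_norm f.
Proof.
have le_normZ k h : dual_norm (k *: h) <= `|k| * dual_norm h.
  apply: dual_norm_le => x x1; rewrite -[(k *: h) x]/(k * h x) normrM.
  by rewrite ler_wpM2l// dual_norm_ub.
have [->|l0] := eqVneq l 0.
  apply/eqP; rewrite eq_le le_normZ/= normr0 mul0r; exact: dual_norm_ge0.
apply/eqP; rewrite eq_le le_normZ/=.
rewrite -ler_pdivlMl ?normr_gt0// -normfV.
by rewrite -[in leLHS](scalerK l0 f) le_normZ.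
Qed.

Lemma dual_norm_eq0 (f : dual) : dual_norm f = 0 -> f = 0.
Proof.
move=> f0; apply: val_inj; apply/funext => x /=.
have [->|x0] := eqVneq x 0; first by rewrite linear0.
have := @dual_norm_ub f (`|x|^-1 *: x).
rewrite f0 normrZ normfV normr_id mulVf ?normr_eq0// lexx normr_le0.
rewrite linearZ/= scaler_eq0 invr_eq0 normr_eq0 (negPf x0)/=.
by move=> /(_ isT)/eqP.
Qed.

HB.instance Definition _ := @Lmodule_isNormed.Build R dual
  dual_norm dual_normD dual_normZ dual_norm_eq0.

End Dual.

Section Riesz.
Variables (R : realType) (Y : hilbertType R).

Lemma inner_sym (x y : Y) : inner x y = inner y x.
Proof. by rewrite hermC /= expr0 mul1r. Qed.

Lemma inner_cauchy_schwarz (x y : Y) : `|inner x y| <= `|x| * `|y|.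
Proof.
have [->|y0] := eqVneq y 0; first by rewrite linear0r !normr0 mulr0.
have a0 : 0 < `|y| ^+ 2 by rewrite exprn_gt0// normr_gt0.
set c := inner x y.
have : 0 <= inner (`|y| ^+ 2 *: x - c *: y) (`|y| ^+ 2 *: x - c *: y).
  by rewrite inner_normE sqr_ge0.
rewrite linearBl !linearBr !linearZl_LR !linearZr_LR /= !inner_normE.
rewrite (inner_sym y x) -/c /GRing.scale/=.
rewrite [X in _ <= X](_ : _ = `|y| ^+ 2 * (`|y| ^+ 2 * `|x| ^+ 2 - c ^+ 2)).
  2: by ring.
rewrite pmulr_rge0// subr_ge0.
rewrite mulrC -exprMn -(real_normK (num_real c)) => h.
by rewrite -(@ler_pXn2r _ 2) ?nnegrE ?mulr_ge0.
Qed.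

Lemma inner_dual (y : Y) : (inner y : Y -> R^o) \in @dual_pred R Y.
Proof.
have lin : linear (inner y : Y -> R^o).
  by move=> a u v; rewrite linearDr linearZr_LR.
apply/asboolP; split => //.
pose f := HB.pack_for {linear Y -> R^o} (inner y : Y -> R^o)
  (GRing.isLinear.Build R Y R^o *:%R (inner y : Y -> R^o) lin).
apply: (@bounded_linear_continuous _ _ _ f); apply/bounded_funP => r.
exists (`|y| * r) => x xr; rewrite (le_trans (inner_cauchy_schwarz _ _))//.
by rewrite ler_wpM2l.
Qed.

(* The map J_Y. *)
Definition riesz (y : Y) : dual Y := Dual (inner_dual y).

(* The map J_Y^{-1}. The default value 0 is never used: J_Y is onto by the
   Riesz representation theorem. *)
Definition riesz_inv : dual Y -> Y := 'pinv_(fun=> 0) [set: Y] riesz.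

Definition dual_inner (s t : dual Y) : R := inner (riesz_inv s) (riesz_inv t).

End Riesz.

Section KernelQuotient.
Variables (R : nzRingType) (U W : lmodType R) (f : {linear U -> W}).

Definition ker_pred : {pred U} := fun x => f x == 0.

Lemma ker_zmod_closed : zmod_closed ker_pred.
Proof.
split=> [|x y]; rewrite !unfold_in /ker_pred ?linear0// linearB.
by move=> /eqP-> /eqP->; rewrite subrr.
Qed.

HB.instance Definition _ := GRing.isZmodClosed.Build U ker_pred ker_zmod_closed.

(* U / ker f *)
Definition ker_quot := Quotient.quot ker_pred.

(* The map induced by f on U / ker f. *)
Definition ker_quot_map (p : ker_quot) : W := f (repr p).

Lemma ker_quot_mapE (x : U) : ker_quot_map (\pi_ker_quot x) = f x.
Proof.
apply/eqP; rewrite -subr_eq0 -linearB /=.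
have : \pi_ker_quot (repr (\pi_ker_quot x)) == \pi_ker_quot x.
  by rewrite reprK.
by rewrite -[_ == _](@Quotient.idealrBE _ ker_pred).
Qed.

End KernelQuotient.

Definition eqsim (R : realType) (T : Type) (a b : T -> R) :=
  exists2 C : R, 0 < C & forall x, a x <= C * b x /\ b x <= C * a x.

(* The relation [rel] is a one-to-one correspondence between the solutions of
   problem [A] and those of problem [B]. *)
Definition equivalent_problems (S T : Type) (A : S -> Prop) (B : T -> Prop)
    (rel : S -> T -> Prop) :=
  (forall s, A s -> exists! t, B t /\ rel s t) /\
  (forall t, B t -> exists! s, A s /\ rel s t).

Section Problems.
Variables (R : realType) (X V Sigma : hilbertType R).
Variables (P Sigmat : completeNormedModType R).
(* The inclusion of Sigma in X'. *)
Variable inc : {linear Sigma -> dual X}.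
Variables (dm : {linear P -> Sigma}) (d : {linear Sigma -> dual V}).
Variables (PiV : {linear V -> Sigmat}) (PiS : {linear Sigmat -> Sigma}).
(* The form (.,.)_X'. *)
Variable b : {symmetric (dual X)}.
Variables (g : dual Sigma) (f : dual V).

(* d^- on P / ker d^-. *)
Let dq : ker_quot dm -> Sigma := ker_quot_map (f := dm).

Definition mixed (su : Sigma * V) : Prop :=
  let: (sigma, u) := su in
  (forall tau : Sigma, b (inc sigma) (inc tau) + d tau u = g tau) /\
  (forall v : V, d sigma v = f v).

Definition decoupled3 (wpu : V * ker_quot dm * V) : Prop :=
  let: (w, p, u) := wpu in
  let sigma := dq p + PiS (PiV w) in
  [/\ forall v : V, inner w v = f v,
      forall q : ker_quot dm, b (inc (dq p)) (inc (dq q)) =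
        g (dq q) - b (inc (PiS (PiV w))) (inc (dq q)) &
      forall chi : V, inner u chi =
        g (PiS (PiV chi)) - b (inc sigma) (inc (PiS (PiV chi)))].

Definition decoupled3_rel (su : Sigma * V) (wpu : V * ker_quot dm * V) :=
  let: (sigma, u) := su in let: (w, p, u') := wpu in
  sigma = dq p + PiS (PiV w) /\ u = u'.

(* The functional g - phi on Sigma sends tau to g tau - inc tau phi. *)
Definition decoupled4 (wphipu : V * X * ker_quot dm * V) : Prop :=
  let: (w, phi, p, u) := wphipu in
  [/\ forall v : V, inner w v = f v,
      forall psi : X, inner phi psi - inc (dq p) psi =
        inc (PiS (PiV w)) psi,
      forall q : ker_quot dm, inc (dq q) phi = g (dq q) &
      forall chi : V, inner u chi =
        g (PiS (PiV chi)) - inc (PiS (PiV chi)) phi].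

Definition decoupled4_rel (su : Sigma * V) (wphipu : V * X * ker_quot dm * V) :=
  let: (sigma, u) := su in let: (w, phi, p, u') := wphipu in
  [/\ sigma = dq p + PiS (PiV w), phi = riesz_inv (inc sigma) & u = u'].

End Problems.

Arguments decoupled3 {R X V Sigma P Sigmat} inc dm PiV PiS b g f wpu.
Arguments decoupled3_rel {R V Sigma P Sigmat} dm PiV PiS su wpu.
Arguments decoupled4 {R X V Sigma P Sigmat} inc dm PiV PiS g f wphipu.
Arguments decoupled4_rel {R X V Sigma P Sigmat} inc dm PiV PiS su wphipu.

(* Main.v *)
Require Import Defs.
From HB Require Import structures.
From mathcomp Require Import all_boot all_order all_algebra.
From mathcomp Require Import sesquilinear.
From mathcomp Require Import all_classical all_reals all_analysis.
From mathcomp Require Import ring lra.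
Import Order.TTheory GRing.Theory Num.Theory.
Import numFieldNormedType.Exports.
Local Open Scope classical_set_scope.
Local Open Scope ring_scope.

(** Write Pi for the composite of PiV and PiS. Since [d (Pi w) = riesz w],
    the map Pi is a right inverse of [d] up to the Riesz isomorphism of V, so
    exactness at Sigma splits every [tau] in Sigma uniquely as [dm q + Pi w],
    where [riesz w = d tau] and [q] is taken modulo the kernel of [dm]
    ([regular_decomposition], [decomposition_inj]). Apply this splitting to
    both the unknown and the test functions of the mixed problem. For
    [sigma = dm p + Pi w] the constraint on [d sigma] only sees [w]. Testing
    with [tau = dm q] makes the term in [u] vanish, which leaves an equation
    for [p]; testing with [tau = Pi chi] turns that term into the inner product
    of [u] and [chi], which leaves an equation for [u]. These two families of
    test functions span Sigma, so nothing is lost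
    ([mixed_iff_decoupled3]).

    When the form on X' is the dual inner product, the pairing of [s] with [t]
    is the value of [t] at the Riesz representative of [s] ([dual_innerE]).
    Naming [phi] the representative of [sigma] and making its defining equation
    part of the system turns the three equations into the four
    ([decoupled4_iff_decoupled3]).

    Both parts rest on the Riesz representation theorem ([riesz_surj]). Its
    proof here has two halves: the range of the Riesz map is dense, because
    near-minimizers of the energy [|v|^2 - 2 f v] almost represent [f]
    ([riesz_dense]), and it is closed, because the map does not shrink norms
    and the space is complete. *)

Lemma dual_bounded {R : realType} {V : normedModType R} (f : dual V) :
  exists M : R, forall x, `|f x| <= M * `|x|.
Proof.
have /linear_bounded_continuous/linear_boundedP := @dual_continuous _ _ f.
by move=> /pinfty_ex_gt0[M _ fM]; exists M.
Qed.

(** Evaluate at [x = y]. This gives both the injectivity of the Riesz map and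
    the Cauchy property of approximate representatives. *)
Lemma riesz_expanding {R : realType} {Y : hilbertType R} (y : Y) (e : R) :
  0 <= e -> (forall x : Y, `|inner y x| <= e * `|x|) -> `|y| <= e.
Proof.
have [->|y0 _ /(_ y)] := eqVneq y 0; first by rewrite normr0.
by rewrite inner_normE normrX normr_id expr2 ler_pM2r ?normr_gt0.
Qed.

(** If the energy [|v|^2 - 2 f v] at [v] is within [e^2] of its infimum, moving
    from [v] along [x] to the vertex of the resulting parabola can lower it by
    at most [e^2]; that drop is [(inner v x - f x)^2 / |x|^2]. *)
Lemma riesz_dense {R : realType} {Y : hilbertType R} (f : dual Y) (e : R) :
  0 < e -> exists v : Y, forall x, `|inner v x - f x| <= e * `|x|.
Proof.
move=> e0; have [M fM] := dual_bounded f.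
pose energy (v : Y) : R := `|v| ^+ 2 - f v *+ 2.
have lb : has_lbound (range energy).
  (* The energy is at least [|v|^2 - 2 M |v|], which is least at [|v| = M]. *)
  exists (- M ^+ 2) => _ [v _ <-]; rewrite /energy.
  have := sqr_ge0 (`|v| - M); have := fM v; have := ler_norm (f v : R).
  by rewrite sqrrB; lra.
have [] := @inf_adherent _ (range energy) (e ^+ 2).
- by rewrite exprn_gt0.
- by split=> //; exists (energy 0), 0.
move=> _ [v _ <-] v_min; exists v => x.
have [->|x0] := eqVneq x 0.
  by rewrite linear0r linear0 subr0 !normr0 mulr0.
have x2 : 0 < `|x| ^+ 2 by rewrite exprn_gt0 // normr_gt0.
set c : R := inner v x - f x.
have step t : energy (v + t *: x) = energy v + (t * c) *+ 2 + t ^+ 2 * `|x| ^+ 2.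
  rewrite /energy -!inner_normE linearDl !linearDr /= !linearZl_LR !linearZr_LR /=.
  have -> : f (v + t *: x) = f v + t * f x by rewrite linearD linearZ.
  rewrite (inner_sym x v) /c; ring.
(* The parabola [t |-> energy (v + t *: x)] has its vertex at
   [t = - c / |x|^2]. *)
have : inf (range energy) <= energy (v - (c / `|x| ^+ 2) *: x).
  by apply: ge_inf => //; exists (v - (c / `|x| ^+ 2) *: x).
rewrite -scaleNr step => le_inf.
have : c ^+ 2 / `|x| ^+ 2 <= e ^+ 2.
  have E : (- (c / `|x| ^+ 2) * c) *+ 2 + (- (c / `|x| ^+ 2)) ^+ 2 * `|x| ^+ 2
     = - (c ^+ 2 / `|x| ^+ 2) by field; rewrite normr_eq0.
  by move: le_inf; rewrite -addrA E; lra.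
rewrite ler_pdivrMr // -exprMn -(real_normK (num_real c)).
by rewrite ler_pXn2r // nnegrE // mulr_ge0 // ltW.
Qed.

(** Riesz representation theorem. Approximate representatives of [f] with
    errors tending to 0 form a Cauchy sequence, since two of them nearly have
    the same inner products; their limit represents [f] exactly. *)
Lemma riesz_surj {R : realType} {Y : hilbertType R} (f : dual Y) :
  exists w : Y, riesz w = f.
Proof.
have /choice[v fv] n : exists v : Y, forall x,
    `|inner v x - f x| <= @harmonic R n * `|x|.
  by apply: riesz_dense; rewrite invr_gt0 ltr0n.
have v_cauchy m n : `|v m - v n| <= @harmonic R m + @harmonic R n.
  apply: riesz_expanding => [|x]; first by rewrite addr_ge0 // harmonic_ge0.
  rewrite linearBl mulrDl /=.
  apply: le_trans (lerD (fv m x) (fv n x)).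
  apply: le_trans (ler_normB _ _).
  by rewrite opprB addrA subrK.
have : cvg (v @ \oo).
  apply/cauchy_cvgP/cauchy_ballP => e e0; near_simpl.
  have half : \forall n \near \oo, @harmonic R n < e / 2.
    by apply: (@near_infty_natSinv_lt R (PosNum (divr_gt0 e0 (ltr0n R 2)))).
  near=> m n; rewrite -ball_normE /=; apply: le_lt_trans (v_cauchy _ _) _.
  by rewrite [ltRHS]splitr; apply: ltrD; [near: m|near: n].
move=> /cvg_ex[w vw]; exists w; apply/val_inj/funext => x /=.
have inner_w : inner (v n) x @[n --> \oo] --> (inner w x : R^o).
  rewrite inner_sym; under eq_fun do rewrite inner_sym.
  exact: continuous_cvg (@dual_continuous _ _ (riesz x) w) vw.
have inner_f : inner (v n) x @[n --> \oo] --> (f x : R^o).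
  apply/subr_cvg0/norm_cvg0P.
  apply: (@squeeze_cvgr _ _ _ _ (cst 0) (fun n => harmonic n * `|x|)).
  - by near=> n; rewrite normr_ge0 /= fv.
  - exact: cvg_cst.
  - by rewrite -[X in _ --> X](mul0r `|x|); apply: cvgMl; apply: cvg_harmonic.
exact: cvg_unique inner_w inner_f.
Unshelve. all: by end_near. Qed.

Lemma inner_inj {R : realType} {Y : hilbertType R} (v w : Y) :
  (forall x, inner v x = inner w x) -> v = w.
Proof.
move=> vw; apply/eqP; rewrite -subr_eq0 -normr_le0.
by apply: riesz_expanding => // x; rewrite linearBl /= vw subrr normr0 mul0r.
Qed.

Lemma riesz_invK {R : realType} {Y : hilbertType R} (s : dual Y) :
  riesz (riesz_inv s) = s.
Proof.
rewrite /riesz_inv; apply: pinvK; rewrite inE.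
by have [w ws] := riesz_surj s; exists w.
Qed.

Lemma riesz_inv_innerE {R : realType} {Y : hilbertType R} (s : dual Y) (x : Y) :
  inner (riesz_inv s) x = s x.
Proof. by rewrite -[in RHS](riesz_invK s). Qed.

Lemma dual_innerE {R : realType} {Y : hilbertType R} (s t : dual Y) :
  dual_inner s t = t (riesz_inv s).
Proof. by rewrite /dual_inner inner_sym riesz_inv_innerE. Qed.

Lemma ker_quot_map_inj {R : nzRingType} {U W : lmodType R}
  {f : {linear U -> W}} : injective (ker_quot_map (f := f)).
Proof.
move=> p q; rewrite -[p]reprK -[q]reprK !ker_quot_mapE => pq.
apply/eqP; rewrite -[_ == _](@Quotient.idealrBE _ (ker_pred f)).
by rewrite unfold_in /ker_pred linearB /= pq subrr.
Qed.

Section Decoupling.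
Variables (R : realType) (X V Sigma : hilbertType R).
Variables (P Sigmat : completeNormedModType R).
Variables (inc : {linear Sigma -> dual X}) (dm : {linear P -> Sigma}).
Variables (d : {linear Sigma -> dual V}) (PiV : {linear V -> Sigmat}).
Variables (PiS : {linear Sigmat -> Sigma}) (b : {symmetric (dual X)}).
Hypothesis exact_Sigma : d @^-1` [set 0] = range dm.
Hypothesis d_PiS_PiV : forall v : V, d (PiS (PiV v)) = riesz v.
Variables (g : dual Sigma) (f : dual V).
Local Notation dq := (ker_quot_map (f := dm)).
Local Notation Pi v := (PiS (PiV v)).

Lemma d_ker_quot_map (q : ker_quot dm) : d (dq q) = 0.
Proof.
have : range dm (dq q) by exists (repr q).
by rewrite -exact_Sigma.
Qed.

(** With [w] the Riesz representative of [d tau], the difference [tau - Pi w]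
    is in the kernel of [d], hence in the range of [dm]. *)
Lemma regular_decomposition (tau : Sigma) : exists w q, tau = dq q + Pi w.
Proof.
have [w w_d] := riesz_surj (d tau).
have [q _ qE] : range dm (tau - Pi w).
  by rewrite -exact_Sigma /= linearB /= d_PiS_PiV w_d subrr.
by exists w, (\pi_(ker_quot dm)%qT q); rewrite ker_quot_mapE qE subrK.
Qed.

Lemma d_decomposition (q : ker_quot dm) (w : V) : d (dq q + Pi w) = riesz w.
Proof. by rewrite linearD /= d_ker_quot_map add0r d_PiS_PiV. Qed.

(** The equations for [p] and [u] are the first mixed equation tested on the
    two summands [dq q] and [Pi chi] of a general element of Sigma. *)
Lemma mixed_iff_decoupled3 {sigma : Sigma} {w : V} {p : ker_quot dm} (u : V) :
  sigma = dq p + Pi w ->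
  mixed inc d b g f (sigma, u) <-> decoupled3 inc dm PiV PiS b g f (w, p, u).
Proof.
move=> sE; rewrite /mixed /decoupled3 -sE.
have dsE : d sigma = riesz w.
  by rewrite sE d_decomposition.
have bE tau : b (inc sigma) tau = b (inc (dq p)) tau + b (inc (Pi w)) tau.
  by rewrite sE linearD linearDl.
split=> [[eq_tau eq_v]|[eq_w eq_p eq_u]].
  split=> [v|q|chi].
  - by rewrite -eq_v dsE.
  - have := eq_tau (dq q); rewrite d_ker_quot_map bE.
    by rewrite -[(0 : dual V) u]/(0 : R) addr0 => <-; rewrite addrK.
  - have := eq_tau (Pi chi); rewrite d_PiS_PiV /= => <-.
    by rewrite addrC addKr inner_sym.
split=> [tau|v]; last by rewrite dsE /= eq_w.
have [chi [q ->]] := regular_decomposition tau.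
rewrite d_decomposition /= inner_sym eq_u !linearD /=.
rewrite [X in X + _ + _]bE eq_p; ring.
Qed.

(** The equation for [phi] says that [riesz phi = inc sigma], that is,
    [phi = riesz_inv (inc sigma)]. Substituting this representative for [sigma]
    in the form on X' turns the remaining equations into each other. *)
Lemma decoupled4_iff_decoupled3
    (b_dual : forall s t : dual X, b s t = dual_inner s t)
    {w : V} {phi : X} {p : ker_quot dm} {u : V} :
  decoupled4 inc dm PiV PiS g f (w, phi, p, u) <->
  decoupled3 inc dm PiV PiS b g f (w, p, u) /\
  phi = riesz_inv (inc (dq p + Pi w)).
Proof.
rewrite /decoupled4 /decoupled3.
set sigma := dq p + Pi w.
have incE psi : inc sigma psi = inc (dq p) psi + inc (Pi w) psi.
  by rewrite linearD.
have bE tau : b (inc (dq p)) (inc tau) =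
    inc tau (riesz_inv (inc sigma)) - b (inc (Pi w)) (inc tau).
  by rewrite -dual_innerE -b_dual linearD linearDl /= addrK.
split=> [[eq_w eq_phi eq_p eq_u]|[[eq_w eq_p eq_u] ->]].
  have phiE : phi = riesz_inv (inc sigma).
    apply: inner_inj => psi.
    by rewrite riesz_inv_innerE incE -eq_phi addrC subrK.
  split=> //; split=> // [q|chi]; first by rewrite bE -phiE eq_p.
  by rewrite eq_u b_dual dual_innerE -phiE.
split=> // [psi|q|chi].
- by rewrite riesz_inv_innerE incE addrC addKr.
- by have := eq_p q; rewrite bE => /addIr.
- by rewrite eq_u b_dual dual_innerE.
Qed.

(** Applying [d] to both sides recovers [w]; the [p] part is then determined
    because [dm] is injective modulo its kernel. *)
Lemma decomposition_inj (p p' : ker_quot dm) (w w' : V) :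
  dq p + Pi w = dq p' + Pi w' -> (p, w) = (p', w').
Proof.
move=> eq_dec; have ww' : w = w'.
  apply: inner_inj => x; rewrite -[LHS]/(riesz w x) -[RHS]/(riesz w' x).
  have := congr1 d eq_dec.
  by rewrite !d_decomposition => ->.
congr (_, _) => //; apply: ker_quot_map_inj.
by move: eq_dec; rewrite ww' => /addIr.
Qed.

Lemma mixed_equivalent_decoupled3 :
  equivalent_problems (mixed inc d b g f)
    (decoupled3 inc dm PiV PiS b g f) (decoupled3_rel dm PiV PiS).
Proof.
split=> [[sigma u] su|[[w p] u] wpu].
  have [w [p sE]] := regular_decomposition sigma.
  exists (w, p, u); split; first by split; [exact/(mixed_iff_decoupled3 u sE)|].
  move=> [[w' p'] u'] [_ [sE' <-]].
  by have [-> ->] : (p, w) = (p', w') by apply: decomposition_inj; rewrite -sE.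
exists (dq p + Pi w, u); split; last by move=> [s u'] [_ [-> ->]].
by split; [exact/mixed_iff_decoupled3|].
Qed.

Lemma mixed_equivalent_decoupled4
    (b_dual : forall s t : dual X, b s t = dual_inner s t) :
  equivalent_problems (mixed inc d b g f)
    (decoupled4 inc dm PiV PiS g f) (decoupled4_rel inc dm PiV PiS).
Proof.
have D4 := decoupled4_iff_decoupled3 b_dual.
split=> [[sigma u] su|[[[w phi] p] u] /D4[wpu phiE]].
  have [w [p sE]] := regular_decomposition sigma.
  exists (w, riesz_inv (inc sigma), p, u); split.
    by split=> //; apply/D4; split; [exact/(mixed_iff_decoupled3 u sE)|rewrite sE].
  move=> [[[w' phi'] p'] u'] [_ [sE' -> <-]].
  by have [-> ->] : (p, w) = (p', w') by apply: decomposition_inj; rewrite -sE.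
exists (dq p + Pi w, u); split; last by move=> [s u'] [_ [-> _ ->]].
by split; [exact/mixed_iff_decoupled3|].
Qed.

End Decoupling.

Theorem theorem3p4 (R : realType) (X V Sigma : hilbertType R)
    (P Sigmat : completeNormedModType R)
    (* the inclusion of Sigma in X' *)
    (inc : {linear Sigma -> dual X}) (inc_inj : injective inc)
    (dm : {linear P -> Sigma}) (dm_cont : continuous dm)
    (d : {linear Sigma -> dual V}) (d_cont : continuous d)
    (PiV : {linear V -> Sigmat}) (PiV_cont : continuous PiV)
    (PiS : {linear Sigmat -> Sigma}) (PiS_cont : continuous PiS)
    (* the form (.,.)_{X'} *)
    (b : {symmetric (dual X)}) (b_ge0 : forall s : dual X, 0 <= b s s)
    (exact_Sigma : d @^-1` [set 0] = range dm)
    (exact_V' : range d = [set: dual V])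
    (d_PiS_PiV : forall v : V, d (PiS (PiV v)) = riesz v)
    (norm_equiv : eqsim (fun tau : Sigma => `|tau| ^+ 2)
       (fun tau => Num.sqrt (b (inc tau) (inc tau)) ^+ 2 + `|d tau| ^+ 2))
    (g : dual Sigma) (f : dual V) :
  equivalent_problems (mixed inc d b g f)
    (decoupled3 inc dm PiV PiS b g f) (decoupled3_rel dm PiV PiS) /\
  ((forall s t : dual X, b s t = dual_inner s t) ->
   equivalent_problems (mixed inc d b g f)
     (decoupled4 inc dm PiV PiS g f) (decoupled4_rel inc dm PiV PiS)).
Proof.
split=> [|b_dual].
  exact: mixed_equivalent_decoupled3.
exact: mixed_equivalent_decoupled4.
Qed.
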